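(* Let $x_t \in \mathbb{X}$ and $(\boldsymbol{x},\boldsymbol{u}) \in \mathbb{C}(x_t)$ be arbitrary. Then, for every $\gamma > 0$, $$\underline{L}(\boldsymbol{x},\boldsymbol{u}) \le \mathcal{L}^{\mathrm{o}}_\gamma(\boldsymbol{x},\boldsymbol{u}) \le \mathbb{E}_{P(\boldsymbol{x})}[L(\boldsymbol{x},\boldsymbol{u})] \le \mathcal{L}^{\mathrm{p}}_\gamma(\boldsymbol{x},\boldsymbol{u}) \le \bar{L}(\boldsymbol{x},\boldsymbol{u}),$$ where $\underline{L}(\boldsymbol{x},\boldsymbol{u}) = \min_{s} L_s(\boldsymbol{x},\boldsymbol{u})$ and $\bar{L}(\boldsymbol{x},\boldsymbol{u}) = \max_{s} L_s(\boldsymbol{x},\boldsymbol{u})$, with $s$ ranging over the leaf nodes $\mathrm{nod}(N)$. Furthermore, with limits taken over $\gamma>0$: (i) $\lim_{\gamma \to 0} \mathcal{L}^{\mathrm{o}}_\gamma(\boldsymbol{x},\boldsymbol{u}) = \mathbb{E}_{P(\boldsymbol{x})}[L(\boldsymbol{x},\boldsymbol{u})]$; (ii) $\lim_{\gamma \to \infty} \mathcal{L}^{\mathrm{o}}_\gamma(\boldsymbol{x},\boldsymbol{u}) = \min_{s} L_s(\boldsymbol{x},\boldsymbol{u})$; (iii) $\lim_{\gamma \to 0} \mathcal{L}^{\mathrm{p}}_\gamma(\boldsymbol{x},\boldsymbol{u}) = \mathbb{E}_{P(\boldsymbol{x})}[L(\boldsymbol{x},\boldsymbol{u})]$; (iv)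 $\lim_{\gamma \to \infty} \mathcal{L}^{\mathrm{p}}_\gamma(\boldsymbol{x},\boldsymbol{u}) = \max_{s} L_s(\boldsymbol{x},\boldsymbol{u})$.
   Context: Data: integers $d, N, n_x, n_u \ge 1$; modes $\Xi = \{1,\dots,d\}$; nonempty closed convex sets $\mathbb{X} \subset \mathbb{R}^{n_x}$, $\mathbb{U} \subset \mathbb{R}^{n_u}$; matrices $\Theta \in \mathbb{R}^{d \times n_x}$, $A_i \in \mathbb{R}^{n_x \times n_x}$, $B_i \in \mathbb{R}^{n_x \times n_u}$ for $i \in \Xi$; convex functions $\ell : \mathbb{R}^{n_x}\times\mathbb{R}^{n_u} \to \mathbb{R}$ and $\ell_N : \mathbb{R}^{n_x} \to \mathbb{R}$. Softmax: $\sigma : \mathbb{R}^d \to \mathbb{R}^d$, $\sigma_i(z) = \exp(z_i)/\sum_{j=1}^d \exp(z_j)$. Scenario tree: a fully branched rooted tree of depth $N$. $\mathrm{nod}(k)$ is the set of nodes at depth $k$; $\mathrm{nod}(a,b) = \bigcup_{k=a}^b \mathrm{nod}(k)$. The root is node $0$. Each node $\iota \in \mathrm{nod}(0,N-1)$ has exactly $d$ children, one for each mode in $\Xi$; a child $\iota_+$ of $\iota$ carries its mode $\xi^{\iota_+} \in \Xi$. Leaves $s \in \mathrm{nod}(N)$ are called scenarios (there are $d^N$ of them), and $\mathrm{anc}(s)$ denotes the nodes on the path from the root to $s$, excluding $s$. For $\iota \in \mathrm{anc}(s)$, $\iota_+$ denotes the child of $\iota$ on the path to $s$. Variables: $\boldsymbol{x}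 = \{x^\iota\}_{\iota \in \mathrm{nod}(0,N)}$ with $x^\iota \in \mathbb{R}^{n_x}$, and $\boldsymbol{u} = \{u^\iota\}_{\iota \in \mathrm{nod}(0,N-1)}$ with $u^\iota \in \mathbb{R}^{n_u}$. The set $\mathbb{C}(x_t)$ consists of all $(\boldsymbol{x},\boldsymbol{u})$ such that $x^0 = x_t$; $x^{\iota_+} = A_{\xi^{\iota_+}} x^\iota + B_{\xi^{\iota_+}} u^\iota$ for every $\iota \in \mathrm{nod}(0,N-1)$ and every child $\iota_+$ of $\iota$; $u^\iota \in \mathbb{U}$ for all $\iota \in \mathrm{nod}(0,N-1)$; and $x^\iota \in \mathbb{X}$ for all $\iota \in \mathrm{nod}(0,N)$. Scenario cost and probability: $L_s(\boldsymbol{x},\boldsymbol{u}) = \ell_N(x^s) + \sum_{\iota \in \mathrm{anc}(s)} \ell(x^\iota,u^\iota)$ and $p(s;\boldsymbol{x}) = \prod_{\iota \in \mathrm{anc}(s)} \sigma_{\xi^{\iota_+}}(\Theta x^\iota)$. $L(\boldsymbol{x},\boldsymbol{u}) \in \mathbb{R}^{d^N}$ and $P(\boldsymbol{x}) \in \mathbb{R}^{d^N}$ are the vectors with entries $L_s(\boldsymbol{x},\boldsymbol{u})$ and $p(s;\boldsymbol{x})$; $P(\boldsymbol{x})$ is a probability vector. For a probability vector $\Pi$ and a vector $X$, $\mathbb{E}_\Pi[X] = \sum_i \Pi_i X_i$. For $\gamma > 0$ (exponentials taken entrywise): $\mathcal{L}^{\mathrm{o}}_\gamma(\boldsymbol{x},\boldsymbol{u})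 = -\frac{1}{\gamma} \ln \mathbb{E}_{P(\boldsymbol{x})}[\exp(-\gamma L(\boldsymbol{x},\boldsymbol{u}))]$ (optimistic cost) and $\mathcal{L}^{\mathrm{p}}_\gamma(\boldsymbol{x},\boldsymbol{u}) = \frac{1}{\gamma} \ln \mathbb{E}_{P(\boldsymbol{x})}[\exp(\gamma L(\boldsymbol{x},\boldsymbol{u}))]$ (pessimistic cost). *)

(* Defs.v *)
From mathcomp Require Import all_boot all_order all_algebra.
From mathcomp Require Import all_classical all_reals all_analysis.

Set Implicit Arguments.
Unset Strict Implicit.
Unset Printing Implicit Defensive.

Import Order.TTheory GRing.Theory Num.Theory.
Import numFieldNormedType.Exports.

Local Open Scope classical_set_scope.
Local Open Scope ring_scope.

(* A node of the fully branched tree is identified with the word of the modes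
   met on the path from the root to it: the root is the empty word, the depth is
   the size, and the modes 1, ..., d are numbered from 0. *)
Notation node d N := {bseq N of 'I_d}.

Notation inner d N := {w : {bseq N of 'I_d} | (size w < N)%N}.

Notation scenario d N := (N.-tuple 'I_d).

Definition root_node (d N : nat) : node d N := [bseq].

Definition node_of_inner (d N : nat) (w : inner d N) : node d N := val w.

Definition node_of_scenario (d N : nat) (s : scenario d N) : node d N :=
  bseq_of_tuple s.

Lemma size_child (d N : nat) (w : inner d N) (i : 'I_d) :
  (size (rcons (val w) i) <= N)%N.
Proof. by rewrite size_rcons (valP w). Qed.

Definition child (d N : nat) (w : inner d N) (i : 'I_d) : node d N :=
  Bseq (size_child w i).

Definition anc (d N : nat) (s : scenario d N) : {set inner d N} :=
  [set w : inner d N | prefix (val w) s]%SET.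

(* For w \in anc s, the mode carried by the child of w on the path to s. *)
Definition next_mode (d N : nat) (s : scenario d N) (w : inner d N) : 'I_d :=
  tnth s (Ordinal (valP w)).

Lemma child_next_mode (d N : nat) (s : scenario d N) (w : inner d N)
    (i : 'I_d) :
  w \in anc s -> prefix (child w i) s = (i == next_mode s w).
Proof.
rewrite inE => /prefixP[t st].
have sw := valP w; have := size_tuple s.
rewrite /child /= st -cats1 /next_mode (tnth_nth i) /= st nth_cat ltnn subnn.
case: t st => [|j t] st /=.
  by rewrite cats0 => sN; move: sw; rewrite /= sN ltnn.
by rewrite prefix_catr // eqxx prefix_cons prefix0s andbT.
Qed.

Definition softmax (R : realType) (d : nat) (z : 'cV[R]_d) : 'cV[R]_d :=
  \col_i (expR (z i 0) / \sum_j expR (z j 0)).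

Definition admissible (R : realType) (d N nx nu : nat)
    (X : set 'cV[R]_nx) (U : set 'cV[R]_nu)
    (A : 'I_d -> 'M[R]_nx) (B : 'I_d -> 'M[R]_(nx, nu)) (xt : 'cV[R]_nx) :
    set ((node d N -> 'cV[R]_nx) * (inner d N -> 'cV[R]_nu)) :=
  [set xu | [/\ xu.1 (root_node d N) = xt,
    forall (w : inner d N) (i : 'I_d),
      xu.1 (child w i) = A i *m xu.1 (node_of_inner w) + B i *m xu.2 w,
    forall w : inner d N, U (xu.2 w) &
    forall w : node d N, X (xu.1 w)]].

Definition scenario_cost (R : realType) (d N nx nu : nat)
    (ell : 'cV[R]_nx * 'cV[R]_nu -> R) (ellN : 'cV[R]_nx -> R)
    (x : node d N -> 'cV[R]_nx) (u : inner d N -> 'cV[R]_nu)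
    (s : scenario d N) : R :=
  ellN (x (node_of_scenario s))
  + \sum_(w in anc s) ell (x (node_of_inner w), u w).

Definition scenario_prob (R : realType) (d N nx : nat) (Theta : 'M[R]_(d, nx))
    (x : node d N -> 'cV[R]_nx) (s : scenario d N) : R :=
  \prod_(w in anc s)
    softmax (Theta *m x (node_of_inner w)) (next_mode s w) 0.

Definition expect (R : realType) (T : finType) (P V : T -> R) : R :=
  \sum_t P t * V t.

Definition optimistic_cost (R : realType) (T : finType) (P V : T -> R)
    (gamma : R) : R :=
  - gamma^-1 * ln (expect P (fun t => expR (- gamma * V t))).

Definition pessimistic_cost (R : realType) (T : finType) (P V : T -> R)
    (gamma : R) : R :=
  gamma^-1 * ln (expect P (fun t => expR (gamma * V t))).

(* Minimum and maximum over a nonempty finite type; the element t0 only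
   witnesses nonemptiness, and the value does not depend on it. *)
Definition fin_min (R : realType) (T : finType) (t0 : T) (V : T -> R) : R :=
  \big[Num.min/V t0]_t V t.

Definition fin_max (R : realType) (T : finType) (t0 : T) (V : T -> R) : R :=
  \big[Num.max/V t0]_t V t.

Definition scenario0 (d N : nat) (hd : (0 < d)%N) : scenario d N :=
  nseq_tuple N (Ordinal hd).

(* Main.v *)
Require Import Defs.
From mathcomp Require Import all_boot all_order all_algebra.
From mathcomp Require Import all_classical all_reals all_analysis.
From mathcomp Require Import lra.
Import Order.TTheory GRing.Theory Num.Theory.
Import numFieldNormedType.Exports.
Local Open Scope classical_set_scope.
Local Open Scope ring_scope.

(** The chain of inequalities and the four limits are facts about a random
    variable V on a finite probability space (T, P), applied to the scenario
    costs.  The optimistic cost of V is minus the pessimistic cost of - V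
    ([optimistic_costN]), and the minimum of V is minus the maximum of - V, so
    only the pessimistic cost, g^-1 * ln E[exp (g V)], has to be studied.

    It lies above the mean by Jensen's inequality, and below max V because
    exp (g V) <= exp (g max V).  As g goes to infinity, keeping in E[exp (g V)]
    only the term of an outcome t at which V is maximal costs g^-1 * ln (P t),
    which tends to 0; this is where P t > 0 is needed.  As g goes to 0, the
    bounds ln y <= y - 1 and exp y - 1 <= y exp y give
    g^-1 * ln E[exp (g V)] <= E[V exp (g V)], whose limit is E[V] by
    continuity of the exponential under a finite sum.

    What remains is that the scenario probabilities are positive, which is
    clear from the softmax, and sum to 1.  The latter holds for any transition
    kernel q w i depending on the whole past w, by induction on the depth
    ([sum_path_prob]); [prod_anc] brings the product over the ancestors of a
    leaf to the form of a product over the dates 0, ..., N - 1. *)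

(** * Exponential certainty equivalents of a random variable on a finite type *)

Lemma expectN {R : realType} {T : finType} (P V : T -> R) :
  expect P (fun t => - V t) = - expect P V.
Proof. by rewrite /expect -sumrN; apply: eq_bigr => t _; rewrite mulrN. Qed.

Lemma fin_minN {R : realType} {T : finType} (t0 : T) (V : T -> R) :
  fin_min t0 V = - fin_max t0 (fun t => - V t).
Proof.
rewrite /fin_min /fin_max (big_morph -%R (@oppr_max R) (erefl _)) opprK.
by apply: eq_bigr => t _; rewrite opprK.
Qed.

Lemma optimistic_costN {R : realType} {T : finType} (P V : T -> R) (g : R) :
  optimistic_cost P V g = - pessimistic_cost P (fun t => - V t) g.
Proof.
rewrite /optimistic_cost /pessimistic_cost mulNr; congr (- (_ * ln _)).
by apply: eq_bigr => t _; rewrite mulNr mulrN.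
Qed.

Lemma le_fin_max {R : realType} {T : finType} (t0 t : T) (V : T -> R) :
  V t <= fin_max t0 V.
Proof. exact: le_bigmax. Qed.

Lemma fin_max_attained {R : realType} {T : finType} (t0 : T) (V : T -> R) :
  exists t, fin_max t0 V = V t.
Proof.
rewrite /fin_max.
elim/big_ind: _ => [|y z [t ->] [s ->]|t _]; first by exists t0.
  by case: (leP (V t) (V s)) => _; [exists s|exists t].
by exists t.
Qed.

Lemma le_expect {R : realType} {T : finType} (P V W : T -> R) :
  (forall t, 0 <= P t) -> (forall t, V t <= W t) -> expect P V <= expect P W.
Proof. by move=> P0 VW; apply: ler_sum => t _; exact: ler_wpM2l. Qed.

Lemma expectD {R : realType} {T : finType} (P V W : T -> R) :
  expect P (fun t => V t + W t) = expect P V + expect P W.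
Proof. by rewrite -big_split; apply: eq_bigr => t _; rewrite mulrDr. Qed.

Lemma expectZ {R : realType} {T : finType} (P V : T -> R) (c : R) :
  expect P (fun t => c * V t) = c * expect P V.
Proof. by rewrite /expect mulr_sumr; apply: eq_bigr => t _; rewrite mulrCA. Qed.

Lemma expect_cst {R : realType} {T : finType} {P : T -> R} (c : R) :
  \sum_t P t = 1 -> expect P (fun=> c) = c.
Proof. by move=> P1; rewrite /expect -mulr_suml P1 mul1r. Qed.

(** Jensen's inequality: the tangent of the exponential at the mean m lies below
    its graph, and the mean of V - m vanishes. *)
Lemma expR_expect_le {R : realType} {T : finType} {P : T -> R} (V : T -> R) :
  (forall t, 0 <= P t) -> \sum_t P t = 1 ->
  expR (expect P V) <= expect P (fun t => expR (V t)).
Proof.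
move=> P0 P1; set m := expect P V.
have -> : expR m = expect P (fun t => expR m * ((1 - m) + V t)).
  by rewrite expectZ expectD (expect_cst _ P1) -/m subrK mulr1.
apply: le_expect => // t; rewrite -[V t in leRHS](addrNK m) expRD mulrC.
rewrite ler_wpM2r ?expR_ge0//; apply: le_trans (expR_ge1Dx _).
by rewrite -addrA [- m + _]addrC.
Qed.

Lemma expect_expR_gt0 {R : realType} {T : finType} (P V : T -> R) :
  (forall t, 0 <= P t) -> \sum_t P t = 1 ->
  0 < expect P (fun t => expR (V t)).
Proof.
move=> P0 P1; apply: lt_le_trans (expR_expect_le V P0 P1); exact: expR_gt0.
Qed.

Lemma expect_le_pessimistic {R : realType} {T : finType} (P V : T -> R)
    (g : R) :
  (forall t, 0 <= P t) -> \sum_t P t = 1 -> 0 < g ->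
  expect P V <= pessimistic_cost P V g.
Proof.
move=> P0 P1 g0; rewrite /pessimistic_cost ler_pdivlMl// -expectZ.
rewrite -[leLHS]expRK ler_ln ?posrE ?expR_gt0 ?expect_expR_gt0//.
exact: expR_expect_le.
Qed.

Lemma pessimistic_le_max {R : realType} {T : finType} (t0 : T) (P V : T -> R)
    (g : R) :
  (forall t, 0 <= P t) -> \sum_t P t = 1 -> 0 < g ->
  pessimistic_cost P V g <= fin_max t0 V.
Proof.
move=> P0 P1 g0; rewrite /pessimistic_cost ler_pdivrMl//.
rewrite -[leRHS]expRK ler_ln ?posrE ?expR_gt0 ?expect_expR_gt0//.
rewrite -[leRHS](expect_cst _ P1); apply: le_expect => // t.
by rewrite ler_expR ler_pM2l// le_fin_max.
Qed.

(** The mean of [exp (g V)] is at least its single term at [t]. *)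
Lemma value_le_pessimistic {R : realType} {T : finType} (P V : T -> R) (t : T)
    (g : R) :
  (forall t, 0 <= P t) -> \sum_t P t = 1 -> 0 < P t -> 0 < g ->
  V t + g^-1 * ln (P t) <= pessimistic_cost P V g.
Proof.
move=> P0 P1 Pt g0; rewrite /pessimistic_cost ler_pdivlMl//.
rewrite mulrDr mulVKf ?gt_eqF//.
rewrite -[g * V t]expRK -lnM ?posrE ?expR_gt0//.
rewrite ler_ln ?posrE ?mulr_gt0 ?expR_gt0 ?expect_expR_gt0//.
rewrite /expect (bigD1 t)//= mulrC lerDl.
by apply: sumr_ge0 => s _; rewrite mulr_ge0 ?expR_ge0.
Qed.

(** An upper bound that involves no logarithm and no division by [g], so that
    its limit as [g] goes to 0 is immediate. *)
Lemma pessimistic_le_tilted {R : realType} {T : finType} (P V : T -> R)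
    (g : R) :
  (forall t, 0 <= P t) -> \sum_t P t = 1 -> 0 < g ->
  pessimistic_cost P V g <= expect P (fun t => V t * expR (g * V t)).
Proof.
move=> P0 P1 g0; rewrite /pessimistic_cost ler_pdivrMl//.
set E := expect P (fun t => expR (g * V t)).
have E0 : 0 < E by exact: expect_expR_gt0.
apply: (@le_trans _ _ (E - 1)).
  by rewrite -[E in ln E](subrKC 1) le_ln1Dx// ltrBrDr addNr.
rewrite -(expect_cst (-1) P1) -expectD -expectZ.
apply: le_expect => // t; set y := g * V t.
(* exp y - 1 <= y exp y is 1 - y <= exp (- y) multiplied by exp y. *)
have := ler_wpM2r (expR_ge0 y) (expR_ge1Dx (- y)).
rewrite -expRD addNr expR0 mulrA -/y; nra.
Qed.

Lemma cvg_pessimistic0 {R : realType} {T : finType} (P V : T -> R) :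
  (forall t, 0 <= P t) -> \sum_t P t = 1 ->
  pessimistic_cost P V g @[g --> 0^'+] --> expect P V.
Proof.
move=> P0 P1.
apply: (@squeeze_cvgr _ _ _ _ (fun=> expect P V)
  (fun g : R => expect P (fun t => V t * expR (g * V t)))).
- near=> g; have g0 : 0 < g by near: g; exact: nbhs_right_gt.
  by rewrite expect_le_pessimistic// pessimistic_le_tilted.
- exact: cvg_cst.
- apply: cvg_at_right_filter; rewrite /expect.
  apply: cvg_big => [|t _]; first exact: add_continuous.
  apply: cvgMl_tmp.
  have : V t * expR (g * V t) @[g --> (0 : R)] --> V t * expR (0 * V t).
    apply: cvgMl_tmp; refine (continuous_cvg _ (@continuous_expR R _) _).
    by apply: cvgMr_tmp; exact: cvg_id.
  by rewrite mul0r expR0 mulr1.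
Unshelve. all: by end_near. Qed.

Lemma cvg_pessimistic_pinfty {R : realType} {T : finType} (t0 : T)
    (P V : T -> R) :
  (forall t, 0 < P t) -> \sum_t P t = 1 ->
  pessimistic_cost P V g @[g --> +oo] --> fin_max t0 V.
Proof.
move=> Pgt P1; have P0 t : 0 <= P t by exact: ltW.
have [t Vt] := fin_max_attained t0 V.
apply: (@squeeze_cvgr _ _ _ _ (fun g => V t + g^-1 * ln (P t))
  (fun=> fin_max t0 V)).
- near=> g; have g0 : 0 < g by near: g; exact: nbhs_pinfty_gt.
  by rewrite value_le_pessimistic// pessimistic_le_max.
- have inv0 : g^-1 @[g --> +oo] --> (0 : R).
    refine (iffRL (gtr0_cvgV0 (f := id) _) cvg_id).
    exact: nbhs_pinfty_gt.
  have : V t + g^-1 * ln (P t) @[g --> +oo] --> V t + 0 * ln (P t).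
    by apply: cvgD; [exact: cvg_cst | exact: cvgMr_tmp].
  by rewrite mul0r addr0 -Vt.
- exact: cvg_cst.
Unshelve. all: by end_near. Qed.

(** * The law of the scenarios *)

Lemma softmax_gt0 (R : realType) (d : nat) (z : 'cV[R]_d) (i : 'I_d) :
  0 < softmax z i 0.
Proof.
rewrite mxE divr_gt0 ?expR_gt0// (bigD1 i)//= ltr_wpDr ?expR_gt0//.
by apply: sumr_ge0 => j _; exact: expR_ge0.
Qed.

Lemma sum_softmax (R : realType) (d : nat) (z : 'cV[R]_d) :
  (0 < d)%N -> \sum_i softmax z i 0 = 1.
Proof.
move=> d0; under eq_bigr do rewrite mxE.
rewrite -mulr_suml divff// gt_eqF// (bigD1 (Ordinal d0))//=.
rewrite ltr_wpDr ?expR_gt0//; apply: sumr_ge0 => j _; exact: expR_ge0.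
Qed.

(** The factors may depend on the whole past, so the induction peels off the
    first letter: the words beginning with [i] contribute [q [::] i] times the
    total mass for the shifted kernel [fun w => q (i :: w)]. *)
Lemma sum_path_prob {R : comPzSemiRingType} {I : finType} (N : nat)
    (q : seq I -> I -> R) :
  (forall w, \sum_i q w i = 1) ->
  \sum_(s : N.-tuple I) \prod_(k < N) q (take k s) (tnth s k) = 1.
Proof.
elim: N q => [|N IH] q q1.
  rewrite (big_pred1 [tuple]) ?big_ord0// => s.
  exact/esym/eqP/tuple0.
pose h (p : I * N.-tuple I) : N.+1.-tuple I := [tuple of p.1 :: p.2].
pose h' (s : N.+1.-tuple I) := (thead s, [tuple of behead s]).
have hK : cancel h h'.
  move=> [i t]; rewrite /h /h' /=; congr (_, _); exact: val_inj.
have h'K : cancel h' h by move=> s; rewrite [RHS]tuple_eta; exact: val_inj.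
rewrite (reindex h) /=; last by exists h' => s _.
transitivity (\sum_i \sum_(t : N.-tuple I)
    \prod_(k < N.+1) q (take k (i :: t)) (tnth [tuple of i :: t] k)).
  by rewrite pair_bigA.
rewrite -[RHS](q1 [::]); apply: eq_bigr => i _.
rewrite -[RHS]mulr1 -[X in _ = _ * X](IH (fun w => q (i :: w))) // mulr_sumr.
apply: eq_bigr => t _; rewrite big_ord_recl /=; congr (_ * _).
by apply: eq_bigr => k _; rewrite tnthS.
Qed.

(** An ancestor of a leaf is a proper prefix of it, hence determined by its
    length; indexing by the length makes induction on the depth possible. *)
Lemma prod_anc (R : comPzSemiRingType) (d N : nat) (s : scenario d N)
    (q : seq 'I_d -> 'I_d -> R) :
  \prod_(w in anc s) q (val (val w)) (next_mode s w) =
  \prod_(k < N) q (take k s) (tnth s k).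
Proof.
have take_lt (k : 'I_N) : (size (take k s) < N)%N.
  by rewrite size_take size_tuple ltn_ord ltn_ord.
pose h (k : 'I_N) : inner d N :=
  exist _ (Bseq (ltnW (take_lt k))) (take_lt k).
rewrite (reindex_onto h (fun w => Ordinal (valP w))) => [|w].
  apply: eq_big => [k|k _].
    rewrite inE prefix_take; apply/eqP/val_inj.
    by rewrite /= size_take size_tuple ltn_ord.
  congr (q _ (tnth s _)); apply: val_inj.
  by rewrite /= size_take size_tuple ltn_ord.
by rewrite inE prefixE => /eqP ws; apply/val_inj/val_inj.
Qed.

Lemma scenario_prob_gt0 (R : realType) (d N nx : nat) (Theta : 'M[R]_(d, nx))
    (x : node d N -> 'cV[R]_nx) (s : scenario d N) :
  0 < scenario_prob Theta x s.
Proof. by apply: prodr_gt0 => w _; exact: softmax_gt0. Qed.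

Lemma sum_scenario_prob (R : realType) (d N nx : nat) (Theta : 'M[R]_(d, nx))
    (x : node d N -> 'cV[R]_nx) :
  (0 < d)%N -> \sum_s scenario_prob Theta x s = 1.
Proof.
move=> d0.
(* insub_bseq only makes the state a function of every word, whatever its size;
   the ancestors of a leaf are short enough to be left unchanged. *)
pose q (w : seq 'I_d) i := softmax (Theta *m x (insub_bseq N w)) i 0.
rewrite -(sum_path_prob N q) => [|w]; last exact: sum_softmax.
apply: eq_bigr => s _; rewrite -prod_anc; apply: eq_bigr => w _.
by rewrite /q /insub_bseq valKd.
Qed.

Theorem lemma1 (R : realType) (d N nx nu : nat)
    (hd : (0 < d)%N) (hN : (0 < N)%N) (hnx : (0 < nx)%N) (hnu : (0 < nu)%N)
    (X : set 'cV[R]_nx) (U : set 'cV[R]_nu)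
    (X_nonempty : X !=set0) (X_closed : closed X) (X_convex : convex_set X)
    (U_nonempty : U !=set0) (U_closed : closed U) (U_convex : convex_set U)
    (Theta : 'M[R]_(d, nx))
    (A : 'I_d -> 'M[R]_nx) (B : 'I_d -> 'M[R]_(nx, nu))
    (ell : 'cV[R]_nx * 'cV[R]_nu -> R) (ellN : 'cV[R]_nx -> R)
    (ell_convex : @convex_function R ('cV[R]_nx * 'cV[R]_nu)%type setT ell)
    (ellN_convex : @convex_function R 'cV[R]_nx setT ellN)
    (xt : 'cV[R]_nx) (hxt : X xt)
    (x : node d N -> 'cV[R]_nx) (u : inner d N -> 'cV[R]_nu)
    (hxu : admissible X U A B xt (x, u)) :
  let P := scenario_prob Theta x in
  let L := scenario_cost ell ellN x u in
  let Lmin := fin_min (scenario0 N hd) L in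
  let Lmax := fin_max (scenario0 N hd) L in
  (forall gamma : R, 0 < gamma ->
    [/\ Lmin <= optimistic_cost P L gamma,
        optimistic_cost P L gamma <= expect P L,
        expect P L <= pessimistic_cost P L gamma &
        pessimistic_cost P L gamma <= Lmax]) /\
  [/\ optimistic_cost P L gamma @[gamma --> 0^'+] --> expect P L,
      optimistic_cost P L gamma @[gamma --> +oo] --> Lmin,
      pessimistic_cost P L gamma @[gamma --> 0^'+] --> expect P L &
      pessimistic_cost P L gamma @[gamma --> +oo] --> Lmax].
Proof.
move=> P L Lmin Lmax.
have Pgt s : 0 < P s by exact: scenario_prob_gt0.
have P0 s : 0 <= P s by exact: ltW.
have P1 : \sum_s P s = 1 by exact: sum_scenario_prob.
have optE : optimistic_cost P L = - pessimistic_cost P (fun s => - L s).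
  by apply/funext => g; exact: optimistic_costN.
have EN : expect P L = - expect P (fun s => - L s) by rewrite expectN opprK.
have minE : Lmin = - fin_max (scenario0 N hd) (fun s => - L s).
  exact: fin_minN.
split=> [g g0|].
  split.
  - by rewrite optE minE lerN2 pessimistic_le_max.
  - by rewrite optE EN lerN2 expect_le_pessimistic.
  - exact: expect_le_pessimistic.
  - exact: pessimistic_le_max.
split.
- by rewrite optE EN; apply: cvgN; exact: cvg_pessimistic0.
- by rewrite optE minE; apply: cvgN; exact: cvg_pessimistic_pinfty.
- exact: cvg_pessimistic0.
- exact: cvg_pessimistic_pinfty.
Qed.
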